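(* As $n\to\infty$ over the integers $n$ for which a Hadamard matrix of order $n$ exists, the number of isomorphism classes of complete MOFS$(n)$ is at least $2^{n^2/4-O(n\log n)}$. That is, there is a constant $C>0$ such that for every sufficiently large $n$ for which a Hadamard matrix of order $n$ exists, there are at least $2^{n^2/4-Cn\log n}$ pairwise non-isomorphic complete MOFS$(n)$.
   Context: Let $N(n)=\{1,\dots,n\}$ and let $n$ be even. A (binary) frequency square of order $n$ is an $n\times n$ array indexed by $N(n)\times N(n)$ with entries in $\{0,1\}$ such that every row and every column contains exactly $n/2$ zeros and $n/2$ ones. Two frequency squares $F,G$ of order $n$ are orthogonal if for each $(a,b)\in\{0,1\}^2$ the number of cells $(r,c)$ with $(F[r,c],G[r,c])=(a,b)$ equals $n^2/4$. A $k$-MOFS$(n)$ is an (ordered) set of $k$ frequency squares of order $n$ that are pairwise orthogonal. A $k$-MOFS$(n)$ is complete if $k=(n-1)^2$. Two sets of MOFS are isomorphic if one can be obtained from the other by a sequence of the operations: applying the same permutation to the rows of all squares; applying the same permutation to the columns of all squares; transposing all squares; interchanging the symbols $0$ and $1$ in one of the squares; permuting the order of the squares in the set. *)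

(* Defs.v *)
From mathcomp Require Import all_boot all_order all_algebra all_fingroup.

Set Implicit Arguments.
Unset Strict Implicit.
Unset Printing Implicit Defensive.

Import GRing.Theory.
Local Open Scope ring_scope.

Definition is_hadamard (n : nat) (H : 'M[int]_n) : Prop :=
  (forall i j, H i j = 1 \/ H i j = -1) /\ H *m H^T = (n%:R)%:M.

(* The symbols 0 and 1 are [false] and [true]. No array satisfies this when n
   is odd, since then n./2 + n./2 <> n. *)
Definition frequency_square (n : nat) (F : 'M[bool]_n) : bool :=
  [forall b : bool,
     [forall r, #|[set c | F r c == b]| == n./2] &&
     [forall c, #|[set r | F r c == b]| == n./2]].

Definition orthogonal_squares (n : nat) (F G : 'M[bool]_n) : bool :=
  [forall a : bool, forall b : bool,
     #|[set rc : 'I_n * 'I_n | (F rc.1 rc.2, G rc.1 rc.2) == (a, b)]|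
     == (n ^ 2 %/ 4)%N].

Definition is_mofs (n k : nat) (F : {ffun 'I_k -> 'M[bool]_n}) : bool :=
  [forall i, frequency_square (F i)] &&
  [forall i, forall j, (i != j) ==> orthogonal_squares (F i) (F j)].

Definition mofs_step (n k : nat) : rel {ffun 'I_k -> 'M[bool]_n} := fun F G =>
  [|| [exists s : 'S_n, G == [ffun i => row_perm s (F i)]],
      [exists s : 'S_n, G == [ffun i => col_perm s (F i)]],
      G == [ffun i => (F i)^T],
      [exists j, G == [ffun i => if i == j then map_mx negb (F i) else F i]]
    | [exists s : 'S_k, G == [ffun i => F (s i)]]].

Definition mofs_iso (n k : nat) : rel {ffun 'I_k -> 'M[bool]_n} :=
  connect (@mofs_step n k).

Definition complete_mofs (n : nat) : {set {ffun 'I_(n.-1 ^ 2) -> 'M[bool]_n}} :=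
  [set F | is_mofs F].

Definition complete_mofs_classes (n : nat) :
    {set {set {ffun 'I_(n.-1 ^ 2) -> 'M[bool]_n}}} :=
  equivalence_partition (@mofs_iso n (n.-1 ^ 2)) (complete_mofs n).

Lemma mofs_step_sym (n k : nat) : symmetric (@mofs_step n k).
Proof.
suff h F G : @mofs_step n k F G -> mofs_step G F.
  by move=> F G; apply/idP/idP; exact: h.
case/or4P => [/existsP[s /eqP->]|/existsP[s /eqP->]|/eqP->|
  /orP[/existsP[j /eqP->]|/existsP[s /eqP->]]]; rewrite /mofs_step.
- apply/or4P/Or41/existsP; exists (s^-1)%g; apply/eqP/ffunP => i.
  by rewrite !ffunE -row_permM mulVg row_perm1.
- apply/or4P/Or42/existsP; exists (s^-1)%g; apply/eqP/ffunP => i.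
  by rewrite !ffunE -col_permM mulVg col_perm1.
- by apply/or4P/Or43/eqP/ffunP => i; rewrite !ffunE trmxK.
- apply/or4P/Or44/orP; left; apply/existsP; exists j; apply/eqP/ffunP => i.
  rewrite !ffunE; case: eqP => // _.
  by apply/matrixP => r c; rewrite !mxE negbK.
- apply/or4P/Or44/orP; right; apply/existsP; exists (s^-1)%g.
  by apply/eqP/ffunP => i; rewrite !ffunE permKV.
Qed.

Lemma mofs_iso_equiv (n k : nat) : equivalence_rel (@mofs_iso n k).
Proof.
apply/equivalence_relP; split=> [F|F G FG H]; first exact: connect0.
exact: (same_connect (sym_connect_sym (@mofs_step_sym n k)) FG).
Qed.

(* Main.v *)
(** Let [g_u] be the [n - 1] nontrivial rows of a normalised Hadamard matrix,
    as sign vectors. The squares [g_u (x) g_v] form a complete set of MOFS.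
    Pair up all but one of the rows; two pairs [a, b] and [c, d] give four
    squares [ac, bc, ad, bd], which can be replaced by
    [(ac + bc + ad + bd) / 2 - x], [x] ranging over the four: these are again
    sign-valued, pairwise orthogonal and span the same space. The choices are
    independent for the [(n/2 - 1)^2] blocks, and different choices give
    families that differ as sets of squares up to sign. Up to order and sign,
    an isomorphism class contains at most [2 (n!)^2] such sets, so there are at
    least [2^((n/2 - 1)^2) / (2 (n!)^2)] classes. *)

Require Import Defs.
From mathcomp Require Import all_boot all_order all_algebra all_fingroup.
From mathcomp Require Import reals exp.
From mathcomp Require Import zify ring.

Set Implicit Arguments.
Unset Strict Implicit.
Unset Printing Implicit Defensive.

Import Order.TTheory GRing.Theory Num.Theory.
Local Open Scope ring_scope.

(** * Sign sums and counting of symbols *)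

Definition sgn (b : bool) : int := (-1) ^+ b.

Lemma sgn_xor a b : sgn (a (+) b) = sgn a * sgn b.
Proof. by rewrite /sgn signr_addb. Qed.

Lemma sgn_sqr b : sgn b * sgn b = 1.
Proof. by case: b. Qed.

Lemma sgn_negb b : sgn (~~ b) = - sgn b.
Proof. by case: b. Qed.

Section Counting.
Variable T : finType.
Implicit Types f g : T -> bool.

Lemma card_sumz (P : pred T) : #|[set t | P t]|%:Z = \sum_t (P t)%:Z.
Proof.
rewrite cardsE -sum1_card -natz natr_sum big_mkcond /=.
by apply: eq_bigr => t _; rewrite unfold_in; case: (P t).
Qed.

(** Twice the indicator of [f t = b], minus 1, is [sgn b * sgn (f t)], whose sum vanishes. *)
Lemma card_balanced f b : \sum_t sgn (f t) = 0 ->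
  (#|[set t | f t == b]| * 2 = #|T|)%N.
Proof.
move=> f0; apply/eqP; rewrite -eqz_nat PoszM card_sumz.
have -> : #|T|%:Z = \sum_(t : T) 1 by rewrite sumr_const -mulr_natr mul1r natz.
rewrite mulr_suml -subr_eq0 -sumrB.
rewrite (eq_bigr (fun t => sgn b * sgn (f t))) -?mulr_sumr ?f0 ?mulr0 // => t _.
by case: (f t); case: (b).
Qed.

(** Four times the indicator is [(1 + sgn a * sgn (f t)) * (1 + sgn b * sgn (g t))]; only the
    constant term survives summation. *)
Lemma card_orthogonal f g a b :
    \sum_t sgn (f t) = 0 -> \sum_t sgn (g t) = 0 ->
    \sum_t sgn (f t) * sgn (g t) = 0 ->
  (#|[set t | (f t, g t) == (a, b)]| * 4 = #|T|)%N.
Proof.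
move=> f0 g0 fg0; apply/eqP; rewrite -eqz_nat PoszM card_sumz.
have -> : #|T|%:Z = \sum_(t : T) 1 by rewrite sumr_const -mulr_natr mul1r natz.
rewrite mulr_suml -subr_eq0 -sumrB.
rewrite (eq_bigr (fun t => sgn a * sgn (f t) + (sgn b * sgn (g t)
  + sgn a * sgn b * (sgn (f t) * sgn (g t))))).
  by rewrite !big_split /= -!mulr_sumr f0 g0 fg0 !mulr0.
by move=> t _; case: (f t) (g t) a b => [] [] [] [].
Qed.

End Counting.

(** * Sign matrices, their inner product and line sums *)

Section SignMatrices.
Variable n : nat.

Definition sgnmx (F : 'M[bool]_n) : 'M[int]_n := map_mx sgn F.

Definition frob (A B : 'M[int]_n) : int := \sum_r \sum_c A r c * B r c.

Lemma frobC A B : frob A B = frob B A.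
Proof. by apply: eq_bigr => r _; apply: eq_bigr => c _; rewrite mulrC. Qed.

Lemma frobDl A B D : frob (A + B) D = frob A D + frob B D.
Proof.
rewrite -big_split; apply: eq_bigr => r _; rewrite -big_split.
by apply: eq_bigr => c _; rewrite mxE mulrDl.
Qed.

Lemma frobZl k A D : frob (k *: A) D = k * frob A D.
Proof.
rewrite /frob mulr_sumr; apply: eq_bigr => r _; rewrite mulr_sumr.
by apply: eq_bigr => c _; rewrite mxE mulrA.
Qed.

Lemma frobNl A D : frob (- A) D = - frob A D.
Proof. by rewrite -scaleN1r frobZl mulN1r. Qed.

Lemma frobDr A B D : frob D (A + B) = frob D A + frob D B.
Proof. by rewrite !(frobC D) frobDl. Qed.

Lemma frobZr k A D : frob D (k *: A) = k * frob D A.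
Proof. by rewrite !(frobC D) frobZl. Qed.

Lemma frobNr A D : frob D (- A) = - frob D A.
Proof. by rewrite !(frobC D) frobNl. Qed.

Definition frobE := (frobDl, frobDr, frobZl, frobZr, frobNl, frobNr).

Lemma frob_sgnmx F : frob (sgnmx F) (sgnmx F) = (n ^ 2)%:Z.
Proof.
rewrite /frob (eq_bigr (fun=> n%:Z)) => [|r _].
  by rewrite sumr_const card_ord -mulr_natr natz -PoszM expnS expn1.
rewrite (eq_bigr (fun=> 1)) => [|c _]; last by rewrite !mxE sgn_sqr.
by rewrite sumr_const card_ord natz.
Qed.

Lemma sgnmx_negb F : sgnmx (map_mx negb F) = - sgnmx F.
Proof. by apply/matrixP => r c; rewrite !mxE sgn_negb. Qed.

Definition zero_sums (A : 'M[int]_n) :=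
  (forall r, \sum_c A r c = 0) /\ (forall c, \sum_r A r c = 0).

Lemma zero_sumsD A B : zero_sums A -> zero_sums B -> zero_sums (A + B).
Proof.
move=> [rA cA] [rB cB]; split=> i; under eq_bigr do rewrite mxE.
  by rewrite big_split /= rA rB.
by rewrite big_split /= cA cB.
Qed.

Lemma zero_sumsZ k A : k != 0 -> zero_sums (k *: A) <-> zero_sums A.
Proof.
have sumZ I (r : seq I) (f : I -> int) (h : I -> int) :
    (forall i, h i = k * f i) -> \sum_(i <- r) h i = k * \sum_(i <- r) f i.
  by move=> hf; rewrite mulr_sumr; apply: eq_bigr.
have rZ r : \sum_c (k *: A) r c = k * \sum_c A r c.
  by apply: sumZ => i; rewrite mxE.
have cZ c : \sum_r (k *: A) r c = k * \sum_r A r c.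
  by apply: sumZ => i; rewrite mxE.
move=> k0; split=> -[rA cA]; split=> i.
- by have /eqP := rA i; rewrite rZ mulf_eq0 (negPf k0) => /eqP.
- by have /eqP := cA i; rewrite cZ mulf_eq0 (negPf k0) => /eqP.
- by rewrite rZ rA mulr0.
- by rewrite cZ cA mulr0.
Qed.

Lemma frequency_square_sums F : zero_sums (sgnmx F) -> frequency_square F.
Proof.
case=> rowF colF; apply/forallP => b; apply/andP; split; apply/forallP => i.
  have := @card_balanced _ (F i) b; rewrite card_ord => Fi.
  apply/eqP; rewrite -[LHS](mulnK _ (isT : 0 < 2)%N) Fi ?divn2 // -[RHS](rowF i).
  by apply: eq_bigr => c _; rewrite mxE.
have := @card_balanced _ (F^~ i) b; rewrite card_ord => Fi.
apply/eqP; rewrite -[LHS](mulnK _ (isT : 0 < 2)%N) Fi ?divn2 // -[RHS](colF i).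
by apply: eq_bigr => c _; rewrite mxE.
Qed.

Lemma orthogonal_squares_frob F G : zero_sums (sgnmx F) -> zero_sums (sgnmx G) ->
  frob (sgnmx F) (sgnmx G) = 0 -> orthogonal_squares F G.
Proof.
move=> [rowF _] [rowG _] FG; apply/forallP => a; apply/forallP => b.
have sum0 K : (forall r, \sum_c sgnmx K r c = 0) ->
    \sum_(t : 'I_n * 'I_n) sgn (K t.1 t.2) = 0.
  move=> rowK; rewrite -(pair_bigA _ (fun r c => sgn (K r c))) big1 //= => r _.
  by rewrite -[RHS](rowK r); apply: eq_bigr => c _; rewrite mxE.
have := @card_orthogonal _ (fun t : 'I_n * 'I_n => F t.1 t.2)
  (fun t => G t.1 t.2) a b (sum0 _ rowF) (sum0 _ rowG).
rewrite card_prod card_ord => FGn.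
apply/eqP; rewrite -[LHS](mulnK _ (isT : 0 < 4)%N) FGn //.
rewrite -(pair_bigA _ (fun r c => sgn (F r c) * sgn (G r c))) -[RHS]FG /=.
by apply: eq_bigr => r _; apply: eq_bigr => c _; rewrite !mxE.
Qed.

End SignMatrices.

(** * An isomorphism invariant and the counting of classes *)

Section Invariant.
Variables n k : nat.
Implicit Types F G : {ffun 'I_k -> 'M[bool]_n}.

(** Forgets the order of the squares and symbol interchanges, so isomorphisms act on it only through
    row and column permutations and transposition. *)
Definition signed_squares F : {set 'M[bool]_n} :=
  [set M | [exists i, (M == F i) || (M == map_mx negb (F i))]].

Definition sym_act (g : 'S_n * 'S_n * bool) (M : 'M[bool]_n) : 'M[bool]_n :=
  let M' := row_perm g.1.1 (col_perm g.1.2 M) in if g.2 then M'^T else M'.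

Lemma negbmxK : involutive (map_mx negb : 'M[bool]_n -> 'M[bool]_n).
Proof. by move=> M; apply/matrixP => r c; rewrite !mxE negbK. Qed.

Lemma signed_squares_map (f : 'M[bool]_n -> 'M[bool]_n) F :
    (forall M, f (map_mx negb M) = map_mx negb (f M)) ->
  signed_squares [ffun i => f (F i)] = f @: signed_squares F.
Proof.
move=> fN; apply/setP => M; rewrite inE; apply/existsP/imsetP.
  case=> i; rewrite ffunE -fN => /orP[] /eqP->.
    by exists (F i) => //; rewrite inE; apply/existsP; exists i; rewrite eqxx.
  exists (map_mx negb (F i)) => //; rewrite inE.
  by apply/existsP; exists i; rewrite eqxx orbT.
case=> M0; rewrite inE => /existsP[i iM] ->; exists i; rewrite ffunE.
by case/orP: iM => /eqP->; rewrite ?fN eqxx ?orbT.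
Qed.

Lemma signed_squares_swap j F :
  signed_squares [ffun i => if i == j then map_mx negb (F i) else F i]
  = signed_squares F.
Proof.
apply/setP => M; rewrite !inE; apply: eq_existsb => i; rewrite ffunE.
by case: (i == j); rewrite ?negbmxK 1?orbC.
Qed.

Lemma signed_squares_perm (s : 'S_k) F :
  signed_squares [ffun i => F (s i)] = signed_squares F.
Proof.
apply/setP => M; rewrite !inE; apply/existsP/existsP => -[i Mi].
  by exists (s i); rewrite ffunE in Mi.
by exists (s^-1 i)%g; rewrite ffunE permKV.
Qed.

(** Induction along the chain of steps: the first step either fixes the signed squares or is
    absorbed into the symmetry given by the rest of the chain. *)
Lemma mofs_iso_signed_squares F G : mofs_iso F G ->
  exists g, signed_squares G = sym_act g @: signed_squares F.
Proof.
case/connectP => p; elim: p F => [|F1 p IH] F /=.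
  move=> _ ->; exists (1%g, 1%g, false); rewrite -[LHS]imset_id.
  by apply: eq_imset => M; rewrite /sym_act /= col_perm1 row_perm1.
case/andP => FF1 /IH{}IH /IH[[[s t] b] ->] {IH}.
case/or4P: FF1 => [/existsP[u /eqP->]|/existsP[u /eqP->]|/eqP->|
    /orP[/existsP[j /eqP->]|/existsP[u /eqP->]]].
- exists (s * u, t, b)%g; rewrite signed_squares_map => [|M]; last first.
    by apply/matrixP => r c; rewrite !mxE.
  rewrite -imset_comp; apply: eq_imset => M.
  by rewrite /sym_act /= row_permM col_row_permC.
- exists (s, t * u, b)%g; rewrite signed_squares_map => [|M]; last first.
    by apply/matrixP => r c; rewrite !mxE.
  by rewrite -imset_comp; apply: eq_imset => M; rewrite /sym_act /= col_permM.
(* Moving the transpose outwards past the permutations exchanges [s] and [t]. *)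
- exists (t, s, ~~ b)%g; rewrite signed_squares_map => [|M]; last first.
    by apply/matrixP => r c; rewrite !mxE.
  rewrite -imset_comp; apply: eq_imset => M.
  rewrite /sym_act /= -tr_row_perm -tr_col_perm -col_row_permC.
  by case: b => //=; rewrite trmxK.
- by exists (s, t, b); rewrite signed_squares_swap.
- by exists (s, t, b); rewrite signed_squares_perm.
Qed.

End Invariant.

(** The index [t] is recovered from the class of [F t] together with one of the [2 * (n!)^2]
    symmetries, carrying the signed squares of a fixed representative to those of [F t]. *)
Lemma card_classes_lower_bound (n : nat) (T : finType)
    (F : T -> {ffun 'I_(n.-1 ^ 2) -> 'M[bool]_n}) :
    (forall t, is_mofs (F t)) ->
    injective (fun t => signed_squares (F t)) ->
  (#|T| <= #|complete_mofs_classes n| * (n`! * n`! * 2))%N.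
Proof.
move=> mofsF injF.
pose cls t := [set G in complete_mofs n | mofs_iso (F t) G].
(* The default is never taken, since [F t] lies in [cls t]; hence [rep t] depends on [cls t]
   alone. *)
pose rep t := odflt (F t) [pick G in cls t].
have FcF t : F t \in cls t by rewrite inE inE mofsF /=; apply: connect0.
have /fin_all_exists[g gP] t :
    exists g, signed_squares (F t) = sym_act g @: signed_squares (rep t).
  apply: mofs_iso_signed_squares; rewrite /rep.
  case: pickP => [G|/(_ (F t))]; last by rewrite FcF.
  rewrite inE => /andP[_].
  by rewrite /mofs_iso (sym_connect_sym (@mofs_step_sym _ _)).
have rep_cls t u : cls t = cls u -> rep t = rep u.
  by rewrite /rep => ->; case: pickP => // /(_ (F u)); rewrite FcF.
have inj : injective (fun t => (cls t, g t)).
  by move=> t u [/rep_cls tu gtu]; apply: injF; rewrite /= !gP tu gtu.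
rewrite -cardsT -(card_imset _ inj).
have -> : (n`! * n`! * 2)%N = #|[set: 'S_n * 'S_n * bool]|.
  by rewrite cardsT !card_prod card_Sn card_bool.
rewrite -cardsX; apply/subset_leq_card/subsetP => _ /imsetP[t _ ->].
rewrite !inE andbT; apply/imsetP; exists (F t) => //.
by rewrite inE mofsF.
Qed.

(* The nontrivial rows of a normalised Hadamard matrix of order [2 * m + 2]:
   [m] pairs of rows and one leftover row. *)
Definition pair_idx (m : nat) : finType := option ('I_m * bool).

(** * Switching blocks of tensor squares *)

Section Switching.
Variables (n m : nat) (g : pair_idx m -> 'I_n -> bool).
Hypothesis g_sum0 : forall u, \sum_c sgn (g u c) = 0.
Hypothesis g_orth : forall u v, u != v -> \sum_c sgn (g u c) * sgn (g v c) = 0.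

Definition tensor (u v : pair_idx m) : 'M[bool]_n :=
  \matrix_(r, c) (g u r (+) g v c).

(* In terms of signs a, b, c, d this is the +-1 combination
   (- ac + bc + ad + bd) / 2 of four tensor squares. *)
Definition twist (p q : 'I_m) (x y : bool) : 'M[bool]_n :=
  \matrix_(r, c)
    (if g (Some (p, x)) r == g (Some (p, ~~ x)) r
     then g (Some (p, x)) r (+) g (Some (q, ~~ y)) c
     else g (Some (p, ~~ x)) r (+) g (Some (q, y)) c).

(** [S] selects the blocks to switch, a block being a pair of row pairs. Squares built from the
    leftover row [None] lie in no block. *)
Definition switched (S : {set 'I_m * 'I_m}) (w : pair_idx m * pair_idx m) :=
  match w with
  | (Some (p, x), Some (q, y)) =>
      if (p, q) \in S then twist p q x y else tensor w.1 w.2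
  | _ => tensor w.1 w.2
  end.

Local Notation T p x q y := (sgnmx (tensor (Some (p, x)) (Some (q, y)))).

(** With signs as above, the right-hand side is 2ad when a = b and 2bc when a = -b, which are the
    two branches of [twist]. The factor 2 keeps the identity over the integers. *)
Lemma sgnmx_twist p q x y : 2 *: sgnmx (twist p q x y) =
  - T p x q y + T p (~~ x) q y + T p x q (~~ y) + T p (~~ x) q (~~ y).
Proof.
apply/matrixP => r c; rewrite !mxE.
by move: (g _ r) (g _ r) (g _ c) (g _ c); do 4 case.
Qed.

Lemma switchedP S w :
  (switched S w = tensor w.1 w.2 /\
     forall p x q y, w = (Some (p, x), Some (q, y)) -> (p, q) \notin S) \/
  exists p x q y, [/\ w = (Some (p, x), Some (q, y)), (p, q) \in S
                    & switched S w = twist p q x y].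
Proof.
case: w => [[[p x]|] [[q y]|]] /=; try by left.
case: ifPn => pqS; [right | left].
  by exists p, x, q, y.
by split=> // p' x' q' y' [<- _ <- _].
Qed.

Lemma zero_sums_tensor u v : zero_sums (sgnmx (tensor u v)).
Proof.
split=> i.
  under eq_bigr do rewrite !mxE sgn_xor.
  by rewrite -mulr_sumr g_sum0 mulr0.
under eq_bigr do rewrite !mxE sgn_xor.
by rewrite -mulr_suml g_sum0 mul0r.
Qed.

Lemma zero_sums_twist p q x y : zero_sums (sgnmx (twist p q x y)).
Proof.
apply/(@zero_sumsZ _ 2) => //; rewrite sgnmx_twist.
do 3![apply: zero_sumsD; last exact: zero_sums_tensor].
by rewrite -scaleN1r; apply/zero_sumsZ => //; apply: zero_sums_tensor.
Qed.

Lemma zero_sums_switched S w : zero_sums (sgnmx (switched S w)).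
Proof.
case: (switchedP S w) => [[-> _]|[p [x [q [y [_ _ ->]]]]]].
  exact: zero_sums_tensor.
exact: zero_sums_twist.
Qed.

(** The inner product factors into those of the row vectors [g u], [g u'] and [g v], [g v']. *)
Lemma frob_tensor u v u' v' :
  frob (sgnmx (tensor u v)) (sgnmx (tensor u' v'))
  = (n ^ 2)%:Z *+ ((u == u') && (v == v')).
Proof.
have [[-> ->]|] := eqVneq (u, v) (u', v'); first by rewrite !eqxx frob_sgnmx.
rewrite -pair_eqE /= => uv; rewrite (negPf uv) mulr0n.
rewrite /frob (eq_bigr (fun r => sgn (g u r) * sgn (g u' r)
    * \sum_c sgn (g v c) * sgn (g v' c))).
  rewrite -mulr_suml; case/nandP: uv => /g_orth ->; first by rewrite mul0r.
  by rewrite mulr0.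
move=> r _; rewrite mulr_sumr; apply: eq_bigr => c _.
by rewrite !mxE !sgn_xor; ring.
Qed.

(** A twisted square involves only the tensors of its own block, so it is orthogonal to everything
    outside. Within a block the coefficient matrix is J - 2I of order 4, whose rows are
    orthogonal. *)
Lemma frob_switched S w w' : w != w' ->
  frob (sgnmx (switched S w)) (sgnmx (switched S w')) = 0.
Proof.
have four0 (z : int) : 2 * (2 * z) = 0 -> z = 0 by lia.
have two0 (z : int) : 2 * z = 0 -> z = 0 by lia.
have tens_twist p x q y v : (p, q) \in S ->
    (forall p x q y, v = (Some (p, x), Some (q, y)) -> (p, q) \notin S) ->
    frob (sgnmx (tensor v.1 v.2)) (sgnmx (twist p q x y)) = 0.
  move=> pqS vS; apply: two0; rewrite -frobZr sgnmx_twist !frobE.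
  have zero x' y' : frob (sgnmx (tensor v.1 v.2)) (T p x' q y') = 0.
    rewrite frob_tensor; case: eqP => //= v1; case: eqP => //= v2.
    have := vS p x' q y'; rewrite -v1 -v2 -surjective_pairing => /(_ erefl).
    by rewrite pqS.
  by rewrite !zero.
case: (switchedP S w) => [[-> wS]|[p [x [q [y [-> pqS ->]]]]]];
  case: (switchedP S w') => [[-> wS']|[p' [x' [q' [y' [-> pqS' ->]]]]]] ww'.
- by rewrite frob_tensor; move: ww'; rewrite -pair_eqE /pair_eq => /negPf->.
- exact: tens_twist.
- by rewrite frobC; apply: tens_twist.
apply: four0; rewrite -frobZr -frobZl !sgnmx_twist !frobE !frob_tensor.
have {ww'} : ~~ [&& (p == p') && (x == x'), q == q' & y == y'].
  by apply: contra ww' => /and3P[/andP[/eqP-> /eqP->] /eqP-> /eqP->].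
rewrite !(inj_eq Some_inj) -!pair_eqE /=.
move: (n ^ 2)%:Z => N.
by case: (p == p') (q == q') x x' y y' => [] [] [] [] [] [] //= _;
  rewrite ?mulr1n ?mulr0n; ring.
Qed.

Hypothesis card_n : n.-1 = (m * 2).+1.

Lemma card_pair_idx2 : (n.-1 ^ 2)%N = #|{: pair_idx m * pair_idx m}|.
Proof. by rewrite card_prod card_option card_prod card_ord card_bool -card_n. Qed.

Definition switched_family (S : {set 'I_m * 'I_m}) :
    {ffun 'I_(n.-1 ^ 2) -> 'M[bool]_n} :=
  [ffun i => switched S (enum_val (cast_ord card_pair_idx2 i))].

Lemma switched_familyP S M : reflect
  (exists w, M = switched S w \/ M = map_mx negb (switched S w))
  (M \in signed_squares (switched_family S)).
Proof.
rewrite inE; apply: (iffP existsP) => [[i]|[w Mw]].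
  rewrite ffunE; set w := enum_val _ => /orP[] /eqP Mw; exists w; tauto.
exists (cast_ord (esym card_pair_idx2) (enum_rank w)).
by rewrite ffunE cast_ordKV enum_rankK; case: Mw => ->; rewrite eqxx ?orbT.
Qed.

Lemma switched_family_mofs S : is_mofs (switched_family S).
Proof.
apply/andP; split; apply/forallP => i.
  by rewrite ffunE; apply/frequency_square_sums/zero_sums_switched.
apply/forallP => j; apply/implyP => ij; rewrite !ffunE.
apply: orthogonal_squares_frob; try exact: zero_sums_switched.
apply: frob_switched.
by rewrite (inj_eq enum_val_inj) (inj_eq (@cast_ord_inj _ _ _)).
Qed.

(* A tensor square of a twisted block has inner product 0 or +-n^2/2 with the
   squares of the family, so it is not among them up to sign. *)
Lemma tensor_notin_switched_family (S : {set 'I_m * 'I_m}) p q x y : (p, q) \in S ->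
  tensor (Some (p, x)) (Some (q, y)) \notin signed_squares (switched_family S).
Proof.
move=> pqS; apply/negP => /switched_familyP[w tw].
have {tw} : frob (T p x q y) (2 *: sgnmx (switched S w)) = 2 * (n ^ 2)%:Z \/
       frob (T p x q y) (2 *: sgnmx (switched S w)) = - (2 * (n ^ 2)%:Z).
  by case: tw => ->; [left | right]; rewrite ?sgnmx_negb !frobE frob_sgnmx ?mulrN.
have n2 : 0 < (n ^ 2)%:Z by rewrite ltz_nat expn_gt0; case: (n) card_n.
case: (switchedP S w) => [[-> wS]|[p' [x' [q' [y' [-> pqS' ->]]]]]].
  rewrite frobE frob_tensor; case: eqP => [w1|_].
    case: eqP => [w2|_]; last by lia.
    have := wS p x q y; rewrite w1 w2 -surjective_pairing pqS.
    by move/(_ erefl).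
  by lia.
rewrite sgnmx_twist !frobE !frob_tensor !(inj_eq Some_inj) -!pair_eqE /=.
move: (n ^ 2)%:Z n2 => N N0.
by case: (p == p') (q == q') x x' y y' => [] [] [] [] [] [];
  rewrite /= ?mulr0n ?mulr1n; lia.
Qed.

(** A block in [S] but not in [S'] leaves its tensor squares in the family of [S'], while they are
    absent from that of [S]. *)
Lemma switched_family_inj :
  injective (fun S => signed_squares (switched_family S)).
Proof.
have sub S S' :
    signed_squares (switched_family S) = signed_squares (switched_family S') ->
    S \subset S'.
  move=> SS'; apply/subsetP => -[p q] pqS; apply/negPn/negP => pqS'.
  have /negP := tensor_notin_switched_family true true pqS; apply.
  rewrite SS'; apply/switched_familyP; exists (Some (p, true), Some (q, true)).
  by left; rewrite /= (negPf pqS').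
by move=> S S' SS'; apply/eqP; rewrite eqEsubset !sub.
Qed.

Lemma classes_ge_switchings :
  (2 ^ (m * m) <= #|complete_mofs_classes n| * (n`! * n`! * 2))%N.
Proof.
have := card_classes_lower_bound switched_family_mofs switched_family_inj.
by rewrite -cardsT -powersetT card_powerset cardsT card_prod card_ord.
Qed.

End Switching.

(** * Balanced orthogonal rows from a Hadamard matrix *)

Lemma hadamard_classes_ge n (H : 'M[int]_n) : (1 < n)%N -> is_hadamard H ->
  exists2 m, n = (m * 2).+2 &
    (2 ^ (m * m) <= #|complete_mofs_classes n| * (n`! * n`! * 2))%N.
Proof.
case: n H => [|n] // H n1 [H1 HHT]; pose h i c := H i c == -1.
have hE i c : sgn (h i c) = H i c by rewrite /h; case: (H1 i c) => ->.
have h_orth i j : i != j -> \sum_c sgn (h i c) * sgn (h j c) = 0.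
  move=> ij; have /matrixP/(_ i j) := HHT; rewrite !mxE (negPf ij) mulr0n => Hij.
  by rewrite -[RHS]Hij; apply: eq_bigr => c _; rewrite !hE mxE.
(* Multiplying columnwise by row 0 normalises that row to all ones and preserves inner products, so
   orthogonality to row 0 becomes zero sum. *)
pose g' (i : 'I_n) c := h (lift ord0 i) c (+) h ord0 c.
have g'_sum0 i : \sum_c sgn (g' i c) = 0.
  under eq_bigr do rewrite sgn_xor.
  by apply: h_orth; rewrite eq_sym neq_lift.
have g'_orth i j : i != j -> \sum_c sgn (g' i c) * sgn (g' j c) = 0.
  move=> ij; rewrite -[RHS](h_orth (lift ord0 i) (lift ord0 j)); last first.
    by rewrite (inj_eq lift_inj).
  apply: eq_bigr => c _; rewrite !sgn_xor mulrACA sgn_sqr.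
  exact: mulr1.
(* A balanced row forces the order [n.+1] to be even. *)
have [m nm] : exists m, n = (m * 2).+1.
  have := card_balanced true (g'_sum0 (Ordinal (n1 : 0 < n)%N)).
  rewrite card_ord; by case: #|_| => [|m] //; rewrite mulSn => -[<-]; exists m.
exists m; first by rewrite nm.
have E : #|pair_idx m| = n by rewrite card_option card_prod card_ord card_bool.
pose g (u : pair_idx m) := g' (cast_ord E (enum_rank u)).
apply: (@classes_ge_switchings _ _ g) => // [u|u v uv]; first exact: g'_sum0.
by apply: g'_orth; rewrite (inj_eq (@cast_ord_inj _ _ _)) (inj_eq enum_rank_inj).
Qed.

(** * The asymptotic estimate *)

Lemma fact_leq_expn n : (n`! <= n ^ n)%N.
Proof.
case: n => // n; rewrite fact_prod big_add1 /= big_mkord.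
have -> : (n.+1 ^ n.+1 = \prod_(i < n.+1) n.+1)%N.
  by rewrite prod_nat_const card_ord.
exact: leq_prod.
Qed.

Theorem theorem4p4 (R : realType) :
  exists C : R, 0 < C /\
  exists N : nat, forall n : nat, (N <= n)%N ->
    (exists H : 'M[int]_n, is_hadamard H) ->
    2 `^ (n%:R ^+ 2 / 4 - C * n%:R * ln n%:R)
      <= (#|complete_mofs_classes n|)%:R :> R.
Proof.
have ln2_gt0 : 0 < ln 2 :> R by rewrite ln_gt0 // ltr1n.
(* With this constant the error term is exactly the factor [n ^ (3 * n)], because [ln] is the
   natural logarithm. *)
exists (3 / ln 2); split; first by rewrite divr_gt0.
exists 2%N => n n2 [H /(hadamard_classes_ge n2)[m nm]].
set K := #|_| => Kge.
have n0 : 0 < n%:R :> R by rewrite ltr0n ltnW.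
(* Here [m.+1] is n/2. Raising the exponent from m^2 to (m+1)^2 costs 2^(n-1), which with the factor
   2 for transposition gives 2^n; this and both factorials are each at most n^n. *)
have natK : (2 ^ (m.+1 * m.+1) <= K * n ^ (3 * n))%N.
  have -> : (m.+1 * m.+1 = m * m + (m * 2).+1)%N by lia.
  rewrite expnD (leq_trans (leq_mul Kge (leqnn _))) // -mulnA leq_mul2l -mulnA.
  rewrite -expnS -nm (_ : 3 * n = n + n + n)%N ?expnD; last by lia.
  by rewrite !leq_mul ?orbT // ?fact_leq_expn // leq_exp2r // ltnW.
have -> : 2 `^ (n%:R ^+ 2 / 4 - 3 / ln 2 * n%:R * ln n%:R)
    = (2 ^ (m.+1 * m.+1))%:R / (n ^ (3 * n))%:R :> R.
  rewrite /powR pnatr_eq0 /= (_ : _ * ln 2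
    = (m.+1 * m.+1)%:R * ln 2 - (3 * n)%:R * ln n%:R).
    by rewrite expRB !expRM_natl !lnK ?posrE // !natrX.
  rewrite !natrM nm; field; exact: lt0r_neq0.
by rewrite ler_pdivrMr -?natrM ?ler_nat // ltr0n expn_gt0 ltnW.
Qed.
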